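(* For all $(q,r)\in\mathbb{H}^+\times\mathbb{H}^+$, the Bergman-Fueter kernel of the quaternionic half space is $$K_{BF}^{\mathbb{H}^+}(q,r)=-4\left[\left(|q|^2+2\mathrm{Re}(q)\overline r+\overline r^2\right)^{-2}+2(\overline q^2+2\overline q\,\overline r+\overline r^2)\left(|q|^2+2\mathrm{Re}(q)\overline r+\overline r^2\right)^{-3}\right].$$ Moreover, setting $P(q,r)=\left(|q|^2+2\mathrm{Re}(q)\overline r+\overline r^2\right)^{-1}$, $$K_{BF}^{\mathbb{H}^+}(q,r)=-4\left[P(q,r)+2K_{\mathbb{H}^+}(q,r)\right]P(q,r).$$
   Context: $\mathbb{H}$ denotes the quaternions and $\mathbb{H}^+=\{q\in\mathbb{H}:\mathrm{Re}(q)>0\}$. The slice Bergman kernel of $\mathbb{H}^+$ (with respect to the normalized measure $\frac1\pi dx\,dy$ on slices) is $$K_{\mathbb{H}^+}(q,r)=(\overline q^2+2\overline q\,\overline r+\overline r^2)\left(|q|^2+2\mathrm{Re}(q)\overline r+\overline r^2\right)^{-2},$$ which for $q,r$ in a common complex plane $\mathbb{C}_J$ ($J^2=-1$) reduces to $(q+\overline r)^{-2}$. The Bergman-Fueter kernel is $K_{BF}^{\mathbb{H}^+}(q,r)=\Delta K_{\mathbb{H}^+}(q,r)$, where $\Delta=\sum_{l=0}^3\partial_{x_l}^2$ is the Laplacian on $\mathbb{R}^4\cong\mathbb{H}$ in the variable $q$. *)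

(* Defs.v *)
From HB Require Import structures.
From mathcomp Require Import all_boot all_order all_algebra.
From mathcomp Require Import all_classical all_reals all_analysis.
From mathcomp Require Import ring lra.

Set Implicit Arguments.
Unset Strict Implicit.
Unset Printing Implicit Defensive.

Import Order.TTheory GRing.Theory Num.Theory.
Import numFieldNormedType.Exports.

Local Open Scope classical_set_scope.
Local Open Scope ring_scope.

(* The quaternion x0 + x1 i + x2 j + x3 k is the row vector (x0, x1, x2, x3).
   The type inherits the real normed module structure of 'rV[R]_4.  The norm
   `|q| of that structure is the sup norm: it gives the usual topology, and
   hence the usual derivatives, but it is not the quaternionic modulus, whose
   square is qnorm2 below. *)
Definition quaternion (R : realType) := 'rV[R]_4.

HB.instance Definition _ (R : realType) :=
  NormedModule.copy (quaternion R) 'rV[R]_4.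

Section Quaternion.
Variable R : realType.
Local Notation H := (quaternion R).
Implicit Types (p q r : H) (a b c d : R).

Definition quat a b c d : H := \row_(l < 4) [:: a; b; c; d]`_l.

Definition qcoord (l : 'I_4) q : R := (q : 'rV[R]_4) 0 l.

Definition qRe q : R := qcoord 0 q.

Definition qconj q : H :=
  quat (qcoord 0 q) (- qcoord 1 q) (- qcoord 2 q) (- qcoord 3 q).

Definition qnorm2 q : R := \sum_(l < 4) qcoord l q ^+ 2.

Definition qone : H := quat 1 0 0 0.

Definition qmul p q : H :=
  let: (a, b, c, d) := (qcoord 0 p, qcoord 1 p, qcoord 2 p, qcoord 3 p) in
  let: (x, y, z, t) := (qcoord 0 q, qcoord 1 q, qcoord 2 q, qcoord 3 q) in
  quat (a * x - b * y - c * z - d * t)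
       (a * y + b * x + c * t - d * z)
       (a * z - b * t + c * x + d * y)
       (a * t + b * z - c * y + d * x).

Definition qinv q : H := (qnorm2 q)^-1 *: qconj q.

Lemma quatP p q :
  qcoord 0 p = qcoord 0 q -> qcoord 1 p = qcoord 1 q ->
  qcoord 2 p = qcoord 2 q -> qcoord 3 p = qcoord 3 q -> p = q.
Proof.
move=> h0 h1 h2 h3; apply/rowP => -[[|[|[|[|//]]]] hl].
- by rewrite (_ : Ordinal hl = 0) //; apply: val_inj.
- by rewrite (_ : Ordinal hl = 1) //; apply: val_inj.
- by rewrite (_ : Ordinal hl = 2) //; apply: val_inj.
- by rewrite (_ : Ordinal hl = 3) //; apply: val_inj.
Qed.

Lemma qcoord_quat a b c d :
  (qcoord 0 (quat a b c d) = a) * (qcoord 1 (quat a b c d) = b) *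
  (qcoord 2 (quat a b c d) = c) * (qcoord 3 (quat a b c d) = d).
Proof. by rewrite /qcoord /quat !mxE. Qed.

Lemma qcoordD l p q : qcoord l (p + q) = qcoord l p + qcoord l q.
Proof. by rewrite /qcoord mxE. Qed.

Lemma qcoordZ l a q : qcoord l (a *: q) = a * qcoord l q.
Proof. by rewrite /qcoord mxE. Qed.

Lemma qcoord0 l : qcoord l 0 = 0.
Proof. by rewrite /qcoord mxE. Qed.

Definition qcoordE := (qcoord_quat, qcoordD, qcoordZ, qcoord0).

Lemma qnorm2E q : qnorm2 q =
  qcoord 0 q ^+ 2 + qcoord 1 q ^+ 2 + qcoord 2 q ^+ 2 + qcoord 3 q ^+ 2.
Proof.
rewrite /qnorm2 !big_ord_recr big_ord0 /= add0r.
by congr (qcoord _ _ ^+ _ + qcoord _ _ ^+ _ + qcoord _ _ ^+ _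
  + qcoord _ _ ^+ _); apply: val_inj.
Qed.

Lemma qnorm2_eq0 q : (qnorm2 q == 0) = (q == 0).
Proof.
apply/eqP/eqP => [|->]; last by rewrite qnorm2E !qcoord0 expr0n /= !addr0.
rewrite qnorm2E => /eqP; rewrite !paddr_eq0 ?addr_ge0 ?sqr_ge0 // !sqrf_eq0.
by move=> /andP[/andP[/andP[/eqP ? /eqP ?] /eqP ?] /eqP ?];
  apply: quatP; rewrite qcoord0.
Qed.

Lemma qmulA : associative qmul.
Proof. by move=> p q r; apply: quatP; rewrite /qmul !qcoordE; ring. Qed.

Lemma qmul1 : left_id qone qmul.
Proof. by move=> q; apply: quatP; rewrite /qmul /qone !qcoordE; ring. Qed.

Lemma qmulr1 : right_id qone qmul.
Proof. by move=> q; apply: quatP; rewrite /qmul /qone !qcoordE; ring. Qed.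

Lemma qmulDl : left_distributive qmul +%R.
Proof. by move=> p q r; apply: quatP; rewrite /qmul !qcoordE; ring. Qed.

Lemma qmulDr : right_distributive qmul +%R.
Proof. by move=> p q r; apply: quatP; rewrite /qmul !qcoordE; ring. Qed.

Lemma qone_neq0 : qone != 0.
Proof.
apply/eqP => /(congr1 (qcoord 0)); rewrite /qone !qcoordE.
by apply/eqP; rewrite oner_eq0.
Qed.

HB.instance Definition _ := GRing.Zmodule_isNzRing.Build (quaternion R)
  qmulA qmul1 qmulr1 qmulDl qmulDr qone_neq0.

Lemma qscaleAl a p q : a *: (p * q) = (a *: p) * q.
Proof. by apply: quatP; rewrite /GRing.mul /= /qmul !qcoordE; ring. Qed.

HB.instance Definition _ :=
  GRing.Lmodule_isLalgebra.Build R (quaternion R) qscaleAl.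

Lemma qscaleAr a p q : a *: (p * q) = p * (a *: q).
Proof. by apply: quatP; rewrite /GRing.mul /= /qmul !qcoordE; ring. Qed.

HB.instance Definition _ :=
  GRing.Lalgebra_isAlgebra.Build R (quaternion R) qscaleAr.

Lemma qmulVr : {in [pred q : H | q != 0], left_inverse 1 qinv *%R}.
Proof.
move=> q; rewrite inE -qnorm2_eq0 qnorm2E => q0.
by apply: quatP; rewrite /GRing.mul /= /qmul /qinv /qconj qnorm2E
  [in RHS]/GRing.one /= /qone !qcoordE; field.
Qed.

Lemma qdivrr : {in [pred q : H | q != 0], right_inverse 1 qinv *%R}.
Proof.
move=> q; rewrite inE -qnorm2_eq0 qnorm2E => q0.
by apply: quatP; rewrite /GRing.mul /= /qmul /qinv /qconj qnorm2E
  [in RHS]/GRing.one /= /qone !qcoordE; field.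
Qed.

Lemma qunitP p q : q * p = 1 /\ p * q = 1 -> p != 0.
Proof.
by move=> [+ _]; apply: contra_eq_neq => ->; rewrite mulr0 eq_sym oner_eq0.
Qed.

Lemma qinv_out : {in [predC [pred q : H | q != 0]], qinv =1 id}.
Proof.
move=> q; rewrite !inE negbK => /eqP ->.
by apply: quatP; rewrite /qinv /qconj !qcoordE ?oppr0 mulr0.
Qed.

HB.instance Definition _ := GRing.NzRing_hasMulInverse.Build (quaternion R)
  qmulVr qdivrr qunitP qinv_out.

Definition half_space : set H := [set q | 0 < qRe q].

Definition qbasis (l : 'I_4) : H := delta_mx 0 l.

Definition laplacian (f : H -> H) (q : H) : H :=
  \sum_(l < 4) 'D_(qbasis l) ('D_(qbasis l) f) q.

(* 'D_v f q is a total operator with an arbitrary value where the limit does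
   not exist; this states that every limit entering laplacian f q exists. *)
Definition laplacian_defined (f : H -> H) (q : H) : Prop :=
  forall l : 'I_4, (\forall p \near q, derivable f p (qbasis l)) /\
    derivable ('D_(qbasis l) f) q (qbasis l).

Definition kernel_numerator q r : H :=
  qconj q ^+ 2 + 2 * qconj q * qconj r + qconj r ^+ 2.

Definition kernel_denominator q r : H :=
  (qnorm2 q)%:A + (2 * qRe q) *: qconj r + qconj r ^+ 2.

Definition bergman_kernel q r : H :=
  kernel_numerator q r * kernel_denominator q r ^- 2.

Definition bergman_fueter_kernel q r : H :=
  laplacian (fun p => bergman_kernel p r) q.

Definition kernel_P q r : H := (kernel_denominator q r)^-1.

End Quaternion.

Arguments half_space {R}.

(* Main.v *)
From HB Require Import structures.
Require Import Defs.
From mathcomp Require Import all_boot all_order all_algebra.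
From mathcomp Require Import all_classical all_reals all_analysis.
From mathcomp Require Import ring lra.

Set Implicit Arguments.
Unset Strict Implicit.
Unset Printing Implicit Defensive.

Import Order.TTheory GRing.Theory Num.Theory.

Local Open Scope classical_set_scope.
Local Open Scope ring_scope.

(** Fix [r], put [s := qconj r], and write [N] and [D] for the numerator and
    the denominator of the kernel, so that [K = N * D ^- 2].  As a function of
    [q], the denominator takes its values in the commutative subalgebra R[s];
    hence [D] commutes with its partial derivatives, and powers of [D] are
    differentiated as in the commutative case
    ([is_derive_qexpVn], [comm_denominator_deriv]).  Only [N] leaves that
    subalgebra, and it always stands on the left.  Differentiating twice along
    a basis vector e_l therefore gives ([is_derive2_bergman])

      N_ll D^-2 - 4 N_l D_l D^-3 - 2 N D_ll D^-3 + 6 N (D_l)^2 D^-4,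

    and the sum over l needs four numbers only:

      sum N_ll = -4,  sum N_l D_l = 4 N,  sum D_ll = 8,  sum (D_l)^2 = 4 D.

    The total is -4 D^-2 + (-16 - 16 + 24) N D^-3 = -4 (D^-2 + 2 N D^-3).

    The second and the last sum come from one identity.  Since D_l is 2 x_l, plus 2 s
    when l = 0, every linear map L satisfies

      sum L(e_l) D_l = 2 (L(q) + L(1) s)      ([sum_mul_denominator_deriv]),

    which is applied to the differentials of [N] and of [D] at [q].

    On the half space [D] does not vanish ([kernel_denominator_neq0]), and the
    half space is open, so the formula for the first derivatives holds near
    [q] and may be differentiated again. *)

(** * Coordinates of quaternions *)

Section Coordinates.
Variable R : realType.
Local Notation H := (quaternion R).
Implicit Types p q r : H.

Lemma qcoordN l q : qcoord l (- q) = - qcoord l q.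
Proof. by rewrite /qcoord mxE. Qed.

Lemma qcoordMn l q n : qcoord l (q *+ n) = qcoord l q *+ n.
Proof. by elim: n => [|n IH]; rewrite ?mulr0n ?qcoord0// !mulrS qcoordD IH. Qed.

Lemma qcoordM p q :
  (qcoord 0 (p * q) = qcoord 0 p * qcoord 0 q - qcoord 1 p * qcoord 1 q
                      - qcoord 2 p * qcoord 2 q - qcoord 3 p * qcoord 3 q) *
  (qcoord 1 (p * q) = qcoord 0 p * qcoord 1 q + qcoord 1 p * qcoord 0 q
                      + qcoord 2 p * qcoord 3 q - qcoord 3 p * qcoord 2 q) *
  (qcoord 2 (p * q) = qcoord 0 p * qcoord 2 q - qcoord 1 p * qcoord 3 q
                      + qcoord 2 p * qcoord 0 q + qcoord 3 p * qcoord 1 q) *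
  (qcoord 3 (p * q) = qcoord 0 p * qcoord 3 q + qcoord 1 p * qcoord 2 q
                      - qcoord 2 p * qcoord 1 q + qcoord 3 p * qcoord 0 q).
Proof. by rewrite /GRing.mul /= /qmul !qcoord_quat. Qed.

Lemma qcoord1 :
  (qcoord 0 (1 : H) = 1) * (qcoord 1 (1 : H) = 0) *
  (qcoord 2 (1 : H) = 0) * (qcoord 3 (1 : H) = 0).
Proof. by rewrite [1]/GRing.one /= /qone !qcoord_quat. Qed.

Lemma qcoord_conj q :
  (qcoord 0 (qconj q) = qcoord 0 q) * (qcoord 1 (qconj q) = - qcoord 1 q) *
  (qcoord 2 (qconj q) = - qcoord 2 q) * (qcoord 3 (qconj q) = - qcoord 3 q).
Proof. by rewrite /qconj !qcoord_quat. Qed.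

(** Expands a coordinate of a polynomial expression in quaternions; [expr2] and
    [mulr_natl] remove squares and numerals, which have no rule of their own. *)
Definition qcoord_simp := (expr2, mulr_natl, qcoordM, qcoord1, qcoord_conj,
  qcoordD, qcoordN, qcoordZ, qcoordMn, qcoord0).

Lemma qcoord_inv l q : qcoord l q^-1 = (qnorm2 q)^-1 * qcoord l (qconj q).
Proof. exact: qcoordZ. Qed.

Lemma qcoord_basis i l : qcoord i (qbasis R l) = (i == l)%:R.
Proof. by rewrite /qcoord /qbasis mxE eqxx. Qed.

Lemma ord4P (P : 'I_4 -> Prop) :
  P 0 -> P 1 -> P 2 -> P 3 -> forall l, P l.
Proof.
move=> h0 h1 h2 h3 [[|[|[|[|//]]]] hl].
- by rewrite (_ : Ordinal hl = 0) //; apply: val_inj.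
- by rewrite (_ : Ordinal hl = 1) //; apply: val_inj.
- by rewrite (_ : Ordinal hl = 2) //; apply: val_inj.
- by rewrite (_ : Ordinal hl = 3) //; apply: val_inj.
Qed.

Lemma sum_ord4 (U : nmodType) (F : 'I_4 -> U) :
  \sum_(l < 4) F l = F 0 + F 1 + F 2 + F 3.
Proof.
rewrite !big_ord_recr big_ord0 /= add0r.
by congr (F _ + F _ + F _ + F _); apply: val_inj.
Qed.

Definition qdot p q : R := \sum_(l < 4) qcoord l p * qcoord l q.

End Coordinates.

(** * Differential calculus for quaternion-valued functions *)

Section Calculus.
Variables (R : realType) (V : normedModType R).
Local Notation H := (quaternion R).
Implicit Types (f g : V -> H) (x v : V) (df dg : H).

(** The quaternions carry no normed algebra structure (the norm here is the sup
    norm), so the product and inverse rules are reduced to real-valued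
    functions through this equivalence. *)
Lemma is_derive_qcoordP f x v df :
  is_derive x v f df <->
  forall l, is_derive x v (fun y => qcoord l (f y)) (qcoord l df).
Proof.
split=> [[dfx <-] l | dfx].
  apply: DeriveDef; first exact: (derivable_mxP f x v).1 dfx 0 l.
  by rewrite /qcoord (derive_mx dfx) mxE.
have fx : derivable f x v.
  by apply/derivable_mxP => i j; rewrite (ord1 i); case: (dfx j).
apply: DeriveDef => //.
by rewrite (derive_mx fx); apply/rowP => j; rewrite mxE; case: (dfx j).
Qed.

Lemma is_derive_qmul f g x v df dg :
  is_derive x v f df -> is_derive x v g dg ->
  is_derive x v (fun y => f y * g y) (df * g x + f x * dg).
Proof.
move=> /is_derive_qcoordP dfx /is_derive_qcoordP dgx.
apply/is_derive_qcoordP.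
have F0 := dfx 0; have F1 := dfx 1; have F2 := dfx 2; have F3 := dfx 3.
have G0 := dgx 0; have G1 := dgx 1; have G2 := dgx 2; have G3 := dgx 3.
apply: ord4P; under eq_fun do rewrite qcoordM;
  by apply: is_derive_eq; rewrite !qcoord_simp /GRing.scale /=; ring.
Qed.

Lemma is_derive_qinv f x v df : f x != 0 -> is_derive x v f df ->
  is_derive x v (fun y => (f y)^-1) (- ((f x)^-1 * df * (f x)^-1)).
Proof.
move=> fx0 /is_derive_qcoordP dfx; apply/is_derive_qcoordP.
have F0 := dfx 0; have F1 := dfx 1; have F2 := dfx 2; have F3 := dfx 3.
have n0 : qnorm2 (f x) != 0 by rewrite qnorm2_eq0.
pose dn := 2 * qdot (f x) df.
have dN : is_derive x v (fun y => qnorm2 (f y)) dn.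
  under eq_fun do rewrite qnorm2E.
  by apply: is_derive_eq; rewrite /dn /qdot sum_ord4 /GRing.scale /=; ring.
have dI : is_derive x v (fun y => (qnorm2 (f y))^-1)
    (- qnorm2 (f x) ^- 2 * dn).
  case: dN => dN <-.
  by apply: DeriveDef; [exact: derivableV | exact: deriveV].
rewrite qnorm2E in n0.
apply: ord4P; under eq_fun do rewrite qcoord_inv qcoord_conj;
  apply: is_derive_eq;
  rewrite qcoordN !qcoordM !qcoord_inv !qcoord_conj;
  rewrite /dn /qdot sum_ord4 qnorm2E /GRing.scale /=; field.
all: exact: n0.
Qed.

(** Without the commutation hypothesis the derivative of a power would be a sum
    of words with [df] in every possible position. *)
Lemma is_derive_qexpVn n f x v df :
  f x != 0 -> GRing.comm (f x) df -> is_derive x v f df ->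
  is_derive x v (fun y => f y ^- n) (- (df * f x ^- n.+1) *+ n).
Proof.
move=> fx0 cdf dfx; have dI := is_derive_qinv fx0 dfx.
have cI : GRing.comm (f x)^-1 df by apply/commr_sym/commrV/commr_sym.
elim: n => [|n IHn].
  by under eq_fun do rewrite expr0 invr1; rewrite mulr0n; exact: is_derive_cst.
under eq_fun do rewrite -exprVn exprS.
have := is_derive_qmul dI IHn.
under eq_fun do rewrite -exprVn.
move/is_derive_eq; apply.
rewrite -!exprVn mulNr mulrnAr mulrN mulNrn mulrA !cI -!mulrA -!exprS.
by rewrite mulrS mulNrn.
Qed.

Lemma is_derive_mulqexpVn n f g x v df dg :
  f x != 0 -> GRing.comm (f x) df ->
  is_derive x v f df -> is_derive x v g dg ->
  is_derive x v (fun y => g y * f y ^- n)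
    (dg * f x ^- n - (g x * df * f x ^- n.+1) *+ n).
Proof.
move=> fx0 cdf dfx dgx.
have := is_derive_qmul dgx (is_derive_qexpVn n fx0 cdf dfx).
by move/is_derive_eq; apply; rewrite mulrnAr mulrN mulNrn mulrA.
Qed.

End Calculus.

(** * Collecting terms in the second derivatives *)

Section Collect.

(** The left side has the shape that [is_derive_mulqexpVn] gives for the
    derivative of [N_l * D ^- 2 - (N * D_l * D ^- 3) *+ 2]; the right side has
    one multiple for each kind of term. *)
Lemma second_derivative_collect (U : zmodType) (a b c e : U) :
  a - b *+ 2 - (b + c - e *+ 3) *+ 2 = a - b *+ 4 - c *+ 2 + e *+ 6.
Proof.
rewrite mulrnBl mulrnDl -mulrnA opprB (mulrnDr b 2 2) (opprD (b *+ 2)).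
move: (b *+ 2) (c *+ 2) (e *+ 6) => b2 c2 e6.
rewrite opprD -!addrA; congr (_ + (_ + _)).
by rewrite [LHS]addrC -addrA.
Qed.

(** The cancellation [D * D ^- 4 = D ^- 3] turns the last sum into a multiple of
    [N * D ^- 3], whose coefficients add up to -16 - 16 + 24 = -8. *)
Lemma laplacian_collect (U : unitRingType) (I : finType) (N D : U)
    (d2N dNdD d2D dD2 : I -> U) : D \is a GRing.unit ->
  \sum_l d2N l = - 4 -> \sum_l dNdD l = N *+ 4 ->
  \sum_l d2D l = 8 -> \sum_l dD2 l = D *+ 4 ->
  \sum_l (d2N l * D ^- 2 - (dNdD l * D ^- 3) *+ 4 - (N * d2D l * D ^- 3) *+ 2
          + (N * dD2 l * D ^- 4) *+ 6)
  = - 4 * (D ^- 2 + 2 * N * D ^- 3).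
Proof.
move=> uD h1 h2 h3 h4; rewrite big_split /= !sumrB !sumrMnl.
rewrite -!mulr_suml -!mulr_sumr h1 h2 h3 h4.
have -> : N * (D *+ 4) * D ^- 4 = (N * D ^- 3) *+ 4.
  by rewrite mulrnAr mulrnAl -mulrA -!exprVn [_ ^+ 4]exprS mulVKr // exprVn.
rewrite mulr_natr mulrnAl -mulrnA mulrDr -!addrA mulNr; congr (_ + _).
rewrite (mulr_natl N 2) !mulNr (mulr_natl _ 4) !mulrnAl -!mulrnA.
move: (N * _) => x; rewrite (_ : 4 * 6 = 4 * 4 + 8)%N // mulrnDr addKr.
by rewrite (_ : 4 * 4 = 8 + 8)%N // mulrnDr opprD -addrA addNr addr0.
Qed.

End Collect.

(** * Derivatives of the Bergman kernel *)

Section Kernel.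
Variable R : realType.
Local Notation H := (quaternion R).
Implicit Types p q r v : H.

(** The differential of [kernel_numerator^~ r] at [p], applied to [v];
    [qconj v] and [qconj p] need not commute, so their two products differ. *)
Definition numerator_deriv r p v : H :=
  qconj v * qconj p + qconj p * qconj v + 2 * qconj v * qconj r.

Definition denominator_deriv r p v : H :=
  (2 * qdot p v)%:A + (2 * qRe v) *: qconj r.

Lemma is_derive_coord p v l : is_derive p v (qcoord l : H -> R) (qcoord l v).
Proof. by have /is_derive_qcoordP/(_ l) := @is_derive_id _ H p v. Qed.

Lemma is_derive_qconj p v : is_derive p v (@qconj R) (qconj v).
Proof.
have c := is_derive_coord p v; apply/is_derive_qcoordP.
apply: ord4P; under eq_fun do rewrite qcoord_conj; rewrite qcoord_conj;
  exact: is_derive_eq.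
Qed.

Lemma is_derive_numerator r p v :
  is_derive p v (fun q => kernel_numerator q r) (numerator_deriv r p v).
Proof.
have c := is_derive_qconj p v.
have c2 := is_derive_qmul c c.
have cr := is_derive_qmul (is_derive_qmul (is_derive_cst (2 : H) p v) c)
  (is_derive_cst (qconj r) p v).
rewrite /kernel_numerator; under eq_fun do rewrite expr2.
apply: is_derive_eq.
by rewrite /numerator_deriv mul0r mulr0 add0r !addr0.
Qed.

Lemma is_derive_denominator r p v :
  is_derive p v (fun q => kernel_denominator q r) (denominator_deriv r p v).
Proof.
have c := is_derive_coord p v.
have c0 := c 0; have c1 := c 1; have c2 := c 2; have c3 := c 3.
apply/is_derive_qcoordP; apply: ord4P;
  under eq_fun do rewrite /kernel_denominator qnorm2E /qRe !qcoord_simp;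
  apply: is_derive_eq;
  rewrite /denominator_deriv /qdot sum_ord4 /qRe !qcoord_simp
    /GRing.scale /=; ring.
Qed.

Lemma is_derive_numerator_deriv r p v :
  is_derive p v (fun p => numerator_deriv r p v) (2 * qconj v ^+ 2).
Proof.
have c := is_derive_qconj p v.
have cl := is_derive_qmul (is_derive_cst (qconj v) p v) c.
have cr := is_derive_qmul c (is_derive_cst (qconj v) p v).
apply: is_derive_eq.
by rewrite mul0r mulr0 add0r !addr0 mulr_natl mulr2n.
Qed.

Lemma is_derive_denominator_deriv r p v :
  is_derive p v (fun p => denominator_deriv r p v) (2 * qnorm2 v)%:A.
Proof.
have c := is_derive_coord p v.
have c0 := c 0; have c1 := c 1; have c2 := c 2; have c3 := c 3.
apply/is_derive_qcoordP; apply: ord4P;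
  under eq_fun do rewrite /denominator_deriv /qdot sum_ord4 /qRe !qcoord_simp;
  apply: is_derive_eq; rewrite qnorm2E !qcoord_simp /GRing.scale /=; ring.
Qed.

(** Both sides are real polynomials in [qconj r]. *)
Lemma comm_denominator_deriv r p v :
  GRing.comm (kernel_denominator p r) (denominator_deriv r p v).
Proof.
have sc (a : R) (x : H) : GRing.comm x a%:A.
  by rewrite /GRing.comm -scalerAl -scalerAr mul1r mulr1.
have cs : GRing.comm (kernel_denominator p r) (qconj r).
  apply/commr_sym/commrD; last exact: commrX.
  apply: commrD; first exact: sc.
  by rewrite /GRing.comm -scalerAl -scalerAr.
apply: commrD; first exact: sc.
by rewrite /GRing.comm -scalerAl -scalerAr cs.
Qed.

(** With [a] and [x] the real parts of [p] and [r], and [v] and [w] the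
    imaginary parts of [p] and [qconj r], the denominator is
    [(a + x + w)^2 + |v|^2].  Its imaginary part [2 (a + x) w] vanishes only if
    [w = 0], because [a + x > 0]; but then it equals
    [(a + x)^2 + |v|^2 > 0]. *)
Lemma kernel_denominator_neq0 p r :
  half_space p -> half_space r -> kernel_denominator p r != 0.
Proof.
rewrite /half_space /= /qRe => hp hr; apply/eqP => D0.
have {D0}E l : qcoord l (kernel_denominator p r) = 0 by rewrite D0 qcoord0.
have := (E 0, E 1, E 2, E 3).
rewrite /kernel_denominator qnorm2E /qRe !qcoord_simp.
move: hp hr.
move: (qcoord 0 p) (qcoord 1 p) (qcoord 2 p) (qcoord 3 p) => a b c d.
move: (qcoord 0 r) (qcoord 1 r) (qcoord 2 r) (qcoord 3 r) => x y z t.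
move=> a0 x0 [[[E0 E1] E2] E3].
have ax : 2 * (a + x) != 0 by apply: lt0r_neq0; lra.
have y0 : y = 0 by apply: (mulfI ax); lra.
have z0 : z = 0 by apply: (mulfI ax); lra.
have t0 : t = 0 by apply: (mulfI ax); lra.
by subst; nra.
Qed.

Lemma near_half_space p : half_space p -> \forall q \near p, half_space q.
Proof.
rewrite /half_space /= => hp.
exact: (@coord_continuous R 1 4 0 0 p _ (lt_nbhsr hp)).
Qed.

Definition bergman_deriv r v p : H :=
  numerator_deriv r p v * kernel_denominator p r ^- 2
  - (kernel_numerator p r * denominator_deriv r p v
     * kernel_denominator p r ^- 3) *+ 2.

Lemma is_derive_bergman r p v : half_space p -> half_space r ->
  is_derive p v (fun q => bergman_kernel q r) (bergman_deriv r v p).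
Proof.
move=> hp hr; apply: is_derive_mulqexpVn.
- exact: kernel_denominator_neq0.
- exact: comm_denominator_deriv.
- exact: is_derive_denominator.
- exact: is_derive_numerator.
Qed.

Lemma is_derive2_bergman r p v : half_space p -> half_space r ->
  is_derive p v ('D_v (fun q => bergman_kernel q r))
    (2 * qconj v ^+ 2 * kernel_denominator p r ^- 2
     - (numerator_deriv r p v * denominator_deriv r p v
        * kernel_denominator p r ^- 3) *+ 4
     - (kernel_numerator p r * (2 * qnorm2 v)%:A
        * kernel_denominator p r ^- 3) *+ 2
     + (kernel_numerator p r * denominator_deriv r p v ^+ 2
        * kernel_denominator p r ^- 4) *+ 6).
Proof.
move=> hp hr; apply: (@near_eq_is_derive _ _ _ (bergman_deriv r v)).
  apply: filterS (near_half_space hp) => q hq.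
  by have [_ ->] := is_derive_bergman v hq hr.
pose D q := kernel_denominator q r; pose N q := kernel_numerator q r.
have D0 : D p != 0 := kernel_denominator_neq0 hp hr.
have cD : GRing.comm (D p) _ := comm_denominator_deriv r p v.
have dD : is_derive p v D _ := is_derive_denominator r p v.
have dN : is_derive p v N _ := is_derive_numerator r p v.
have dN1 := is_derive_mulqexpVn 2 D0 cD dD (is_derive_numerator_deriv r p v).
have dN2 := is_derive_mulqexpVn 3 D0 cD dD
  (is_derive_qmul dN (is_derive_denominator_deriv r p v)).
have {dN1 dN2} := is_deriveB dN1 (is_deriveD dN2 dN2).
move/is_derive_eq; apply; rewrite -/(D p) -/(N p) -mulr2n.
rewrite [(_ + N p * _) * _]mulrDl [denominator_deriv _ _ _ ^+ 2]expr2.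
rewrite [N p * (_ * _)]mulrA.
move: (2 * _ ^+ 2 * _) (_ * _ * D p ^- 3) (N p * _%:A * _) (N p * _ * _ * _).
exact: second_derivative_collect.
Qed.

(** * Contractions over the standard basis *)

(** The four squares are those of the conjugated basis: 1, -1, -1, -1. *)
Lemma laplacian_numerator :
  \sum_(l < 4) 2 * qconj (qbasis R l) ^+ 2 = - 4.
Proof.
by rewrite sum_ord4; apply: quatP; rewrite !qcoord_simp !qcoord_basis /=; ring.
Qed.

Fact qconj_is_linear : linear (@qconj R).
Proof. by move=> a u v; apply: quatP; rewrite !qcoord_simp //; ring. Qed.

HB.instance Definition _ := GRing.isLinear.Build R H H _ (@qconj R)
  qconj_is_linear.

Fact numerator_deriv_is_linear r p : linear (numerator_deriv r p).
Proof.
move=> a u v; rewrite /numerator_deriv linearP !(mulrDl, mulrDr) !scalerDr.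
rewrite -!(scalerAl, scalerAr).
by rewrite [X in X + _ = _]addrACA [X in _ + X = _]addrACA [LHS]addrACA.
Qed.

HB.instance Definition _ r p := GRing.isLinear.Build R H H _
  (numerator_deriv r p) (numerator_deriv_is_linear r p).

Fact denominator_deriv_is_linear r p : linear (denominator_deriv r p).
Proof.
move=> a u v; rewrite /denominator_deriv /qdot !sum_ord4 /qRe.
by apply: quatP; rewrite !qcoord_simp; ring.
Qed.

HB.instance Definition _ r p := GRing.isLinear.Build R H H _
  (denominator_deriv r p) (denominator_deriv_is_linear r p).

Lemma sum_qcoord_basis p : \sum_(l < 4) qcoord l p *: qbasis R l = p.
Proof. by rewrite [RHS]row_sum_delta. Qed.

Lemma qbasis0 : qbasis R 0 = 1.
Proof. by apply: quatP; rewrite qcoord1 qcoord_basis. Qed.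

(** The directional derivatives of the denominator along the basis are the
    coordinates of [2 p], plus [2 (qconj r)] along [1]; contracting with the
    former reassembles [p] by linearity of [L]. *)
Lemma sum_mul_denominator_deriv (L : {linear H -> H}) r p :
  \sum_(l < 4) L (qbasis R l) * denominator_deriv r p (qbasis R l) =
  (L p + L 1 * qconj r) *+ 2.
Proof.
have De l : denominator_deriv r p (qbasis R l) =
    (qcoord l p)%:A *+ 2 + (qconj r *+ (l == 0)) *+ 2.
  rewrite /denominator_deriv /qRe qcoord_basis /qdot (bigD1 l) //= big1.
    rewrite qcoord_basis eqxx mulr1 addr0 -scalerA scaler_nat -scalerA.
    by rewrite !scaler_nat eq_sym.
  by move=> i il; rewrite qcoord_basis (negbTE il) mulr0.
under eq_bigr do rewrite De -mulrnDl mulrnAr mulrDr -scalerAr mulr1 -linearZ /=.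
rewrite sumrMnl big_split /= -linear_sum sum_qcoord_basis; congr ((_ + _) *+ 2).
rewrite (bigD1 0) //= big1 ?addr0 ?qbasis0 //.
by move=> l /negbTE ->; rewrite mulr0.
Qed.

Lemma sum_numerator_denominator r p :
  \sum_(l < 4) numerator_deriv r p (qbasis R l)
    * denominator_deriv r p (qbasis R l) = kernel_numerator p r *+ 4.
Proof.
rewrite sum_mul_denominator_deriv /= /numerator_deriv /kernel_numerator.
have -> : qconj (1 : H) = 1 by apply: quatP; rewrite !qcoord_simp ?oppr0.
rewrite mul1r mulr1; move: (qconj p) (qconj r) => c s.
rewrite -!mulr2n mulr1 !(mulr_natl _ 2) !mulrnAl -mulrnDl -mulrnDl mulrnAl.
rewrite -mulrnDl -mulrnA mulrDl -!expr2; congr (_ *+ 4).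
by rewrite addrA -(addrA (c ^+ 2)) -mulr2n.
Qed.

Lemma laplacian_denominator :
  \sum_(l < 4) (2 * qnorm2 (qbasis R l))%:A = 8 :> H.
Proof.
by rewrite sum_ord4 !qnorm2E !qcoord_basis; apply: quatP;
  rewrite !qcoord_simp /=; ring.
Qed.

Lemma gradient_denominator r p :
  \sum_(l < 4) denominator_deriv r p (qbasis R l) ^+ 2 =
  kernel_denominator p r *+ 4.
Proof.
under eq_bigr do rewrite expr2.
rewrite sum_mul_denominator_deriv /= /denominator_deriv /kernel_denominator.
by rewrite /qdot !sum_ord4 /qRe qnorm2E; apply: quatP;
  rewrite !qcoord_simp; ring.
Qed.

(** * The Bergman-Fueter kernel *)

Lemma bergman_fueter_kernelE p r : half_space p -> half_space r ->
  bergman_fueter_kernel p r =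
  - 4 * (kernel_denominator p r ^- 2
         + 2 * kernel_numerator p r * kernel_denominator p r ^- 3).
Proof.
move=> hp hr; rewrite /bergman_fueter_kernel /laplacian.
under eq_bigr do
  rewrite (@derive_val _ _ _ _ _ _ _ (is_derive2_bergman _ hp hr)).
apply: laplacian_collect.
- exact: kernel_denominator_neq0.
- exact: laplacian_numerator.
- exact: sum_numerator_denominator.
- exact: laplacian_denominator.
- exact: gradient_denominator.
Qed.

End Kernel.

Theorem theorem6p11 (R : realType) (q r : quaternion R)
    (hq : half_space q) (hr : half_space r) :
  [/\ laplacian_defined (fun p => bergman_kernel p r) q,
      bergman_fueter_kernel q r =
        - 4 * (((qnorm2 q)%:A + (2 * qRe q) *: qconj r + qconj r ^+ 2) ^- 2
          + 2 * (qconj q ^+ 2 + 2 * qconj q * qconj r + qconj r ^+ 2)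
            * ((qnorm2 q)%:A + (2 * qRe q) *: qconj r + qconj r ^+ 2) ^- 3)
    & bergman_fueter_kernel q r =
        - 4 * (kernel_P q r + 2 * bergman_kernel q r) * kernel_P q r].
Proof.
split.
- move=> l; split; last by have [] := is_derive2_bergman (qbasis R l) hq hr.
  apply: filterS (near_half_space hq) => p hp.
  by have [] := is_derive_bergman (qbasis R l) hp hr.
- exact: bergman_fueter_kernelE.
- rewrite bergman_fueter_kernelE // /kernel_P /bergman_kernel.
  rewrite -!exprVn; move: (kernel_denominator q r)^-1 => P.
  by rewrite -[RHS]mulrA [in RHS](mulrDl P) (exprSr P 2) (expr2 P) !mulrA.
Qed.
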